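(* Let $d=1$, let $Z=(X,Y)$ where $X$ and $Y$ are two independent Poisson random variables with $\mathbb{E}[X]=\mathbb{E}[Y]=1$, let $\mathsf{Z}=\mathbb{R}^2$, and let $f:\mathbb{R}\times\mathsf{Z}\to\mathbb{R}$ be defined by $$f(\theta,z)=-z_2z_1\theta+\exp(\theta z_1),\qquad\theta\in\mathbb{R},\ z=(z_1,z_2)\in\mathbb{R}^2.$$ Let $F(\theta)=\mathbb{E}[f(\theta,Z)]$ and $\theta_\star=\arg\min_{\theta\in\mathbb{R}}F(\theta)$. Then Assumption 1 and Assumption 2 (as stated in the context) are satisfied with $\alpha=1$.
   Context: Here $\nabla^kf(\theta,z)$ denotes the $k$-th derivative of $f$ with respect to $\theta$. Assumption 1. For every compact set $\Theta\subset\mathbb{R}^d$ there is a constant $c_\Theta>0$ such that $F(a\theta_1+(1-a)\theta_2)\le aF(\theta_1)+(1-a)F(\theta_2)-\frac{c_\Theta}{2}a(1-a)\|\theta_1-\theta_2\|^2$ for all $a\in[0,1]$ and $(\theta_1,\theta_2)\in\Theta^2$. Assumption 2 (with exponent $\alpha\in(0,1]$). The map $\theta\mapsto f(\theta,z)$ is twice continuously differentiable on $\mathbb{R}^d$ for all $z\in\mathsf{Z}$; $\mathbb{E}[\|\nabla^2 f(\theta_\star,Z)\|]<\infty$ and $\mathbb{E}[\|\nabla f(\theta_\star,Z)\|^{1+\alpha}]<\infty$; and for every compact $\Theta\subset\mathbb{R}^d$ there is a measurable $M_\Theta:\mathsf{Z}\to[0,\infty)$ with $\mathbb{E}[M_\Theta(Z)]<\infty$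 such that, almost surely, $\|\nabla^2 f(\theta,Z)-\nabla^2 f(\theta',Z)\|\le M_\Theta(Z)\|\theta-\theta'\|$ for all $(\theta,\theta')\in\Theta^2$. *)

(* Defs.v *)
From HB Require Import structures.
From mathcomp Require Import all_boot all_order all_algebra.
From mathcomp Require Import all_classical all_reals all_analysis.

Set Implicit Arguments.
Unset Strict Implicit.
Unset Printing Implicit Defensive.

Import Order.TTheory GRing.Theory Num.Theory.
Import numFieldNormedType.Exports.

(* With the scopes opened in this order, [g^`()] on a function is its analytic
   derivative, not the formal derivative of a polynomial. *)
Local Open Scope ring_scope.
Local Open Scope classical_set_scope.

(* The parameter space is the line, so that gradients and Hessians are scalar
   derivatives and every norm is the absolute value. *)
Definition nabla {S : Type} {R : realType} (k : nat) (f : R -> S -> R) (t : R)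
    (z : S) : R :=
  ((f ^~ z)^`(k))%classic t.

(* [fine] maps the values +oo and -oo to 0, so this is the expected objective
   only where [f t \o Z] is integrable. *)
Definition objective {d d'} {T : measurableType d} {S : measurableType d'}
    {R : realType} (P : probability T R) (Z : T -> S) (f : R -> S -> R)
    (t : R) : R :=
  fine 'E_P[fun w => f t (Z w)]%E.

Definition argmin {R : realType} (F : R -> R) : set R :=
  [set t | forall t', F t <= F t'].

Definition twice_continuously_differentiable {R : realType} (g : R -> R) :
    Prop :=
  [/\ forall t, derivable g t 1,
      forall t, derivable (g^`()) t 1
    & continuous (g^`(2))].

Definition assumption1 {R : realType} (F : R -> R) : Prop :=
  forall K : set R, compact K ->
  exists2 c : R, 0 < c &
    forall a t1 t2 : R, 0 <= a <= 1 -> K t1 -> K t2 ->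
      F (a * t1 + (1 - a) * t2) <=
        a * F t1 + (1 - a) * F t2 - c / 2 * a * (1 - a) * `|t1 - t2| ^+ 2.

(* A condition E[g] < oo on a nonnegative [g] is rendered by integrability,
   i.e. it includes the measurability of [g]. *)
Definition assumption2 {d d'} {T : measurableType d} {S : measurableType d'}
    {R : realType} (P : probability T R) (Z : T -> S) (f : R -> S -> R)
    (tstar alpha : R) : Prop :=
  [/\ 0 < alpha <= 1,
      forall z, twice_continuously_differentiable (f ^~ z),
      P.-integrable setT (fun w => `|nabla 2 f tstar (Z w)|%:E),
      P.-integrable setT (fun w =>
        (`|nabla 1 f tstar (Z w)| `^ (1 + alpha))%:E)
    & forall K : set R, compact K ->
      exists M : S -> R,
        [/\ measurable_fun setT M,
            forall z, 0 <= M z,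
            P.-integrable setT (fun w => (M (Z w))%:E)
          & {ae P, forall w, forall t t' : R, K t -> K t' ->
              `|nabla 2 f t (Z w) - nabla 2 f t' (Z w)|
                <= M (Z w) * `|t - t'|}]].

Definition poisson_rv {d} {T : measurableType d} {R : realType}
    (P : probability T R) (X : T -> R) : Prop :=
  exists2 lambda : R, 0 < lambda &
    forall k : nat, P (X @^-1` [set k%:R]) = (poisson_pmf lambda k)%:E.

Definition independent_rv {d d1 d2} {T : measurableType d}
    {S1 : measurableType d1} {S2 : measurableType d2} {R : realType}
    (P : probability T R) (X : T -> S1) (Y : T -> S2) : Prop :=
  forall A B, measurable A -> measurable B ->
    P (X @^-1` A `&` Y @^-1` B) = (P (X @^-1` A) * P (Y @^-1` B))%E.

Definition poisson_loss {R : realType} (t : R) (z : R * R) : R :=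
  - (z.2 * z.1 * t) + expR (t * z.1).

(* Main.v *)
Require Import Defs.
From mathcomp Require Import all_boot all_order all_algebra.
From mathcomp Require Import all_classical all_reals all_analysis.
From mathcomp Require Import measurable_realfun ring lra.

Import Order.TTheory GRing.Theory Num.Theory.
Import numFieldNormedType.Exports.

Local Open Scope classical_set_scope.
Local Open Scope ring_scope.

(** A Poisson variable sits almost surely on the naturals, so every expectation
    is a series against the mass function.  This yields the mean of [X], its
    moment generating function [exp (lambda (exp t - 1))], finite at every [t],
    and, summing over the atoms of both variables, [E[XY] = E[X] E[Y] = 1].
    The mean condition forces [lambda = 1], hence
    [F t = - t + exp (exp t - 1)].

    This closed form settles the two claims about [F].  The bound
    [exp u >= 1 + u], used twice, gives [F t >= 1 = F 0] with equality only at
    [0] ([argmin_mean_loss]).  Strong convexity on compacts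
    ([assumption1_mean_loss]) is inherited from the inner exponential: its
    convexity gap survives the outer exponential, which is convex and, on
    arguments at least [-1], has slope at least [exp (-1)].

    The moment conditions of [assumption2] all follow from one principle
    ([integrable_exp_bound]): a measurable variable dominated by
    [exp (s |X|) + exp (s |Y|)] is integrable, because the generating functions
    are finite everywhere.  The derivatives at [0] are polynomials in [X] and
    [Y], and the second derivative [x^2 exp (t x)] is Lipschitz in [t] on
    [[-B, B]] with constant [|x|^3 exp (B |x|)]
    ([poisson_hessian_lipschitz]). *)

(** * Inequalities for the exponential *)

(** For [x >= -2], squaring [1 + x/2 <= exp (x/2)] gives the quadratic term with
    coefficient [1/4].  For [x < -2] the left-hand side is already negative:
    [|x| <= D] bounds the quadratic term by [|x| / 2]. *)
Lemma expR_quadratic_lb {R : realType} (D x : R) :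
  2 <= D -> `|x| <= D -> 1 + x + x ^+ 2 / (2 * D) <= expR x.
Proof.
move=> D2 xD.
have D0 : 0 < D by exact: lt_le_trans D2.
have [x2|x2] := lerP (-2) x.
  have sqr : (1 + x / 2) ^+ 2 <= expR x.
    rewrite [x in expR x](_ : x = x / 2 + x / 2); last by field.
    rewrite expRD -expr2 lerXn2r// ?nnegrE ?expR_ge0 ?expR_ge1Dx//; lra.
  apply: le_trans sqr.
  have : x ^+ 2 / (2 * D) <= x ^+ 2 / 4.
    by rewrite ler_wpM2l ?sqr_ge0// lef_pV2 ?posrE; lra.
  by lra.
have : x ^+ 2 / (2 * D) <= - x / 2.
  rewrite ler_pdivrMr ?mulr_gt0//.
  move: xD; rewrite ltr0_norm; last by lra.
  by nra.
by have := expR_ge0 x; lra.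
Qed.

(** The quadratic lower bound is expanded around the midpoint [m] and averaged:
    the linear terms cancel, and [a (t1 - m)^2 + (1 - a) (t2 - m)^2] equals
    [a (1 - a) (t1 - t2)^2]. *)
Lemma expR_strongly_convex {R : realType} {B a t1 t2 : R} :
  1 <= B -> `|t1| <= B -> `|t2| <= B -> 0 <= a <= 1 ->
  expR (a * t1 + (1 - a) * t2)
    + expR (- B) / (4 * B) * a * (1 - a) * (t1 - t2) ^+ 2
  <= a * expR t1 + (1 - a) * expR t2.
Proof.
move=> B1 t1B t2B /andP[a0 a1].
set m := a * t1 + (1 - a) * t2.
have /andP[mB1 mB2] : - B <= m <= B.
  move: t1B t2B; rewrite !ler_norml /m => /andP[? ?] /andP[? ?].
  by apply/andP; split; nra.
(* Two points of [-B, B] are at distance at most 2 B, whence the constant. *)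
have lb u : `|u| <= B ->
    expR m * (1 + (u - m) + (u - m) ^+ 2 / (2 * (2 * B))) <= expR u.
  move=> uB.
  rewrite [leRHS](_ : _ = expR m * expR (u - m)); last by rewrite -expRD subrKC.
  rewrite ler_wpM2l ?expR_ge0//.
  apply: expR_quadratic_lb; first by lra.
  by move: uB; rewrite !ler_norml => /andP[? ?]; apply/andP; split; lra.
have h1 := ler_wpM2l a0 (lb _ t1B).
have h2 : (1 - a) * _ <= (1 - a) * _ := ler_wpM2l _ (lb _ t2B).
apply: le_trans (lerD h1 (h2 _)); last by lra.
have em : expR (- B) <= expR m by rewrite ler_expR.
have B0 : 0 < B by lra.
rewrite [leRHS](_ : _ =
    expR m + expR m * (a * (1 - a) * (t1 - t2) ^+ 2 / (4 * B))); last first.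
  by rewrite /m; field; lra.
rewrite lerD2l.
rewrite [leLHS](_ : _ =
    expR (- B) * (a * (1 - a) * (t1 - t2) ^+ 2 / (4 * B))); last first.
  by field; lra.
rewrite ler_wpM2r// divr_ge0 ?(mulr_ge0 (mulr_ge0 _ _) (sqr_ge0 _)) ?subr_ge0//.
by lra.
Qed.

Lemma expR_lipschitz {R : realType} {c u v : R} :
  u <= c -> v <= c -> `|expR u - expR v| <= expR c * `|u - v|.
Proof.
wlog uv : u v / v <= u => [H|].
  have [vu|uv] := orP (le_total v u); first exact: H.
  by move=> uc vc; rewrite distrC (distrC u) H.
move=> uc vc.
rewrite !ger0_norm ?subr_ge0 ?ler_expR//.
apply: (@le_trans _ _ (expR u * (u - v))); last first.
  by rewrite ler_wpM2r ?subr_ge0// ler_expR.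
rewrite [expR v](_ : _ = expR u * expR (v - u)); last by rewrite -expRD subrKC.
rewrite -[X in X - _]mulr1 -mulrBr.
by rewrite ler_wpM2l ?expR_ge0//; have := expR_ge1Dx (v - u); lra.
Qed.

Lemma normr_le_expR {R : realType} (x : R) : `|x| <= expR `|x|.
Proof. by have := expR_ge1Dx `|x|; lra. Qed.

(** Turns the products of exponentials that bound mixed moments into the sums
    that dominate integrable variables. *)
Lemma expRM_le_add {R : realType} (s x y : R) :
  expR (s * x) * expR (s * y) <= expR (2 * s * x) + expR (2 * s * y).
Proof.
rewrite -!mulrA !expRM_natl.
have := expR_ge0 (s * x); have := expR_ge0 (s * y); nra.
Qed.

(** * Derivatives of the loss *)

Lemma is_derive_poisson_loss {R : realType} (z : R * R) (t : R) :
  is_derive t 1 (poisson_loss ^~ z) (- (z.2 * z.1) + z.1 * expR (t * z.1)).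
Proof.
rewrite (_ : poisson_loss ^~ z = fun s => - (z.2 * z.1 * s) + expR (s * z.1))//.
apply: is_derive_eq.
by rewrite /GRing.scale/=; ring.
Qed.

Lemma derive1_poisson_loss {R : realType} (z : R * R) :
  (poisson_loss ^~ z)^`()%classic =
  fun t => - (z.2 * z.1) + z.1 * expR (t * z.1).
Proof.
apply/funext => t; rewrite derive1E.
by have [_ ->] := is_derive_poisson_loss z t.
Qed.

Lemma is_derive2_poisson_loss {R : realType} (z : R * R) (t : R) :
  is_derive t 1 (poisson_loss ^~ z)^`()%classic (z.1 ^+ 2 * expR (t * z.1)).
Proof.
rewrite derive1_poisson_loss.
apply: is_derive_eq.
by rewrite /GRing.scale/=; ring.
Qed.

Lemma derive2_poisson_loss {R : realType} (z : R * R) :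
  (poisson_loss ^~ z)^`(2)%classic = fun t => z.1 ^+ 2 * expR (t * z.1).
Proof.
apply/funext => t; rewrite derive1nS derive1E derive1n1.
by have [_ ->] := is_derive2_poisson_loss z t.
Qed.

Lemma nabla1_poisson_loss {R : realType} (t : R) (z : R * R) :
  nabla 1 poisson_loss t z = - (z.2 * z.1) + z.1 * expR (t * z.1).
Proof. by rewrite /nabla derive1n1 derive1_poisson_loss. Qed.

Lemma nabla2_poisson_loss {R : realType} (t : R) (z : R * R) :
  nabla 2 poisson_loss t z = z.1 ^+ 2 * expR (t * z.1).
Proof. by rewrite /nabla derive2_poisson_loss. Qed.

Lemma poisson_loss_C2 {R : realType} (z : R * R) :
  twice_continuously_differentiable (poisson_loss ^~ z).
Proof.
split => [t|t|].
- by have [] := is_derive_poisson_loss z t.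
- by have [] := is_derive2_poisson_loss z t.
- rewrite derive2_poisson_loss => t.
  apply: cvgM; first exact: cvg_cst.
  apply: continuous_comp; last exact: continuous_expR.
  exact: mulrr_continuous.
Qed.

Lemma poisson_hessian_lipschitz {R : realType} {B x t t' : R} :
  `|t| <= B -> `|t'| <= B ->
  `|x ^+ 2 * expR (t * x) - x ^+ 2 * expR (t' * x)|
    <= `|x| ^+ 3 * expR (B * `|x|) * `|t - t'|.
Proof.
move=> tB t'B.
have le s : `|s| <= B -> s * x <= B * `|x|.
  by move=> sB; apply: le_trans (ler_norm _) _; rewrite normrM ler_wpM2r.
rewrite -mulrBr normrM ger0_norm ?sqr_ge0// -(@real_normK _ x) ?num_real//.
have := expR_lipschitz (le _ tB) (le _ t'B).
rewrite -mulrBl normrM => h.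
apply: le_trans (ler_wpM2l (sqr_ge0 `|x|) h) _.
by rewrite le_eqVlt; apply/orP; left; apply/eqP; ring.
Qed.

(** * Series of the Poisson mass function *)

Lemma poisson_pmfE {R : realType} (lambda : R) (k : nat) : 0 < lambda ->
  poisson_pmf lambda k = lambda ^+ k / k`!%:R * expR (- lambda).
Proof. by rewrite /poisson_pmf => ->. Qed.

Lemma poisson_pmf_sum1 {R : realType} (lambda : R) : 0 < lambda ->
  (\sum_(k <oo) (poisson_pmf lambda k)%:E = 1)%E.
Proof.
move=> l0.
have := probability_setT (poisson_prob lambda 0).
rewrite /= /poisson_prob l0 -nneseries_esumT// => k.
by rewrite lee_fin poisson_pmf_ge0.
Qed.

(** The identity [(k + 1) p(k + 1) = lambda p(k)] shifts the series onto the
    total mass. *)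
Lemma poisson_pmf_mean {R : realType} (lambda : R) : 0 < lambda ->
  (\sum_(k <oo) (k%:R%:E * (poisson_pmf lambda k)%:E) = lambda%:E)%E.
Proof.
move=> l0.
have ge0 k : (0 <= k%:R%:E * (poisson_pmf lambda k)%:E)%E.
  by rewrite mule_ge0// lee_fin ?poisson_pmf_ge0.
rewrite nneseries_recl// mul0e add0e -nneseries_addn//.
transitivity (\sum_(k <oo) (lambda%:E * (poisson_pmf lambda k)%:E))%E.
  apply: eq_eseriesr => k _; rewrite -!EFinM !poisson_pmfE// addn1.
  congr EFin; rewrite factS natrM exprS invfM.
  field; rewrite !pnatr_eq0 -lt0n fact_gt0/=.
  by rewrite nat1r pnatr_eq0.
rewrite nneseriesZl ?poisson_pmf_sum1 ?mule1// => k _.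
by rewrite lee_fin poisson_pmf_ge0.
Qed.

(** The weight [exp (t k)] tilts the mass function of rate [lambda] into that of
    rate [lambda exp t], up to the announced factor. *)
Lemma poisson_pmf_mgf {R : realType} (lambda t : R) : 0 < lambda ->
  (\sum_(k <oo) ((expR (t * k%:R))%:E * (poisson_pmf lambda k)%:E)
   = (expR (lambda * (expR t - 1)))%:E)%E.
Proof.
move=> l0.
have lt0 : 0 < lambda * expR t by rewrite mulr_gt0 ?expR_gt0.
transitivity (\sum_(k <oo) ((expR (lambda * (expR t - 1)))%:E *
    (poisson_pmf (lambda * expR t) k)%:E))%E.
  apply: eq_eseriesr => k _; rewrite -!EFinM !poisson_pmfE//; congr EFin.
  rewrite expRM_natr exprMn.
  rewrite [expR (- lambda)](_ : _ = expR (lambda * (expR t - 1)) *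
    expR (- (lambda * expR t))); last by rewrite -expRD; congr expR; ring.
  by ring.
rewrite nneseriesZl ?poisson_pmf_sum1 ?mule1// => k _.
by rewrite lee_fin poisson_pmf_ge0.
Qed.

(** * Integration over the atoms of a Poisson variable *)

Section poisson_atoms.
Context {d : measure_display} {T : measurableType d} {R : realType}
  {P : probability T R} {X : {RV P >-> R}}.
Hypothesis hX : poisson_rv P X.

Lemma trivIset_atom : trivIset setT (fun k : nat => X @^-1` [set k%:R]).
Proof.
apply/trivIsetP => i j _ _ ij; apply/seteqP; split => // w [/= -> /eqP].
by rewrite eqr_nat (negbTE ij).
Qed.

Let measurable_atoms : measurable (\bigcup_k X @^-1` [set k%:R]).
Proof.
apply: bigcup_measurable => k _.
by rewrite -[X in measurable X]setTI; exact: measurable_funPT.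
Qed.

(** The prescribed masses of the atoms already sum to one. *)
Lemma poisson_rv_nat : P (~` \bigcup_k X @^-1` [set k%:R]) = 0%E.
Proof.
have [lambda l0 hp] := hX.
rewrite probability_setC// measure_semi_bigcup//.
- rewrite (eq_eseriesr (fun k _ => hp k)).
  by rewrite poisson_pmf_sum1// subee.
- exact: trivIset_atom.
Qed.

Lemma poisson_rv_ae_normr : {ae P, forall w, `|X w| = X w}.
Proof.
exists (~` \bigcup_k X @^-1` [set k%:R]).
split; [exact: measurableC|exact: poisson_rv_nat|].
move=> w /= nw [k _ /= Xk]; apply: nw; rewrite Xk.
by rewrite ger0_norm.
Qed.

Lemma ge0_integral_atoms {A : set T} {f : T -> \bar R} :
  measurable A -> measurable_fun A f -> (forall w, A w -> 0 <= f w)%E ->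
  (\int[P]_(w in A) f w =
   \sum_(k <oo) \int[P]_(w in A `&` X @^-1` [set k%:R]) f w)%E.
Proof.
move=> mA mf f0.
rewrite (ge0_negligible_integral (measurableC measurable_atoms))//; last first.
  exact: poisson_rv_nat.
rewrite setDE setCK setI_bigcupr ge0_integral_bigcup//.
- apply: measurable_funS mf => //; first by move=> w [k _ []].
- by move=> w [k _ [Aw _]]; exact: f0.
- exact/trivIset_setIl/trivIset_atom.
Qed.

(** The set [A] is kept general so that it can be an atom of a second
    variable. *)
Lemma ge0_integral_comp_atoms {A : set T} {g : R -> R} :
  measurable A -> measurable_fun setT g -> (forall x, 0 <= g x) ->
  (\int[P]_(w in A) (g (X w))%:E =
   \sum_(k <oo) ((g k%:R)%:E * P (A `&` X @^-1` [set k%:R])))%E.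
Proof.
move=> mA mg g0; rewrite ge0_integral_atoms//.
- apply: eq_eseriesr => k _.
  rewrite -integral_cst; last exact: measurableI.
  by apply: eq_integral => w; rewrite inE => -[_ /= ->].
- apply/measurable_EFinP; apply: measurable_funTS.
  exact: measurableT_comp.
- by move=> w _; rewrite lee_fin.
Qed.

End poisson_atoms.

(** * Moments of Poisson variables *)

Section poisson_moments.
Context {d : measure_display} {T : measurableType d} {R : realType}
  {P : probability T R}.
Implicit Types X Y : {RV P >-> R}.

(** Passing to absolute values makes the nonnegative integration over atoms
    applicable to expectations. *)
Lemma poisson_expectation_abs {X} : poisson_rv P X ->
  (\int[P]_w `|X w|%:E = 'E_P[X])%E.
Proof.
move=> hX; rewrite expectation_def; apply: ae_eq_integral => //.
- by apply/measurable_EFinP; apply: measurableT_comp.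
- exact/measurable_EFinP.
- by apply: filterS (poisson_rv_ae_normr hX) => w /= -> _.
Qed.

Lemma poisson_expectation {X} {lambda : R} : 0 < lambda ->
  (forall k : nat, P (X @^-1` [set k%:R]) = (poisson_pmf lambda k)%:E) ->
  'E_P[X]%E = lambda%:E.
Proof.
move=> l0 hp; have hX : poisson_rv P X by exists lambda.
rewrite -poisson_expectation_abs// (ge0_integral_comp_atoms hX)//.
rewrite -[RHS]poisson_pmf_mean//; apply: eq_eseriesr => k _.
by rewrite setTI hp normr_nat.
Qed.

Lemma poisson_mgf {X} {lambda : R} (t : R) : 0 < lambda ->
  (forall k : nat, P (X @^-1` [set k%:R]) = (poisson_pmf lambda k)%:E) ->
  (\int[P]_w (expR (t * X w))%:E = (expR (lambda * (expR t - 1)))%:E)%E.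
Proof.
move=> l0 hp; have hX : poisson_rv P X by exists lambda.
rewrite (ge0_integral_comp_atoms hX (g := fun x => expR (t * x)))//.
- rewrite -[RHS]poisson_pmf_mgf//; apply: eq_eseriesr => k _.
  by rewrite setTI hp.
- by apply: measurableT_comp => //; exact: measurable_funM.
Qed.

Lemma integrable_poisson_expR {X} (t : R) : poisson_rv P X ->
  P.-integrable setT (fun w => (expR (t * X w))%:E).
Proof.
move=> [lambda l0 hp]; apply/integrableP; split.
  apply/measurable_EFinP; apply: measurableT_comp => //.
  exact: measurable_funM.
under eq_integral do rewrite gee0_abs ?lee_fin ?expR_ge0//.
by rewrite (poisson_mgf _ l0 hp) ltry.
Qed.

(** Since [exp (s |x|) <= exp (s x) + exp (- s x)], the bound is a sum of values
    of moment generating functions, which are finite everywhere. *)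
Lemma integrable_exp_bound {X Y} (s : R) {g : T -> R} :
  poisson_rv P X -> poisson_rv P Y -> measurable_fun setT g ->
  (forall w, `|g w| <= expR (s * `|X w|) + expR (s * `|Y w|)) ->
  P.-integrable setT (fun w => (g w)%:E).
Proof.
move=> hX hY mg gb.
have ie (Z : {RV P >-> R}) (hZ : poisson_rv P Z) : P.-integrable setT
    ((fun w => (expR (s * Z w))%:E) \+ (fun w => (expR ((- s) * Z w))%:E))%E.
  by apply: integrableD => //; exact: integrable_poisson_expR.
apply: (le_integrable _ _ _ (integrableD _ (ie _ hX) (ie _ hY))) => //.
  exact/measurable_EFinP.
move=> w _.
rewrite /= lee_fin [leRHS]ger0_norm ?addr_ge0 ?expR_ge0//.
apply: le_trans (gb w) _.
have h z : expR (s * `|z|) <= expR (s * z) + expR (- s * z).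
  by case: (ger0P z) => _; rewrite ?mulrN ?mulNr ?lerDl ?lerDr expR_ge0.
exact: lerD.
Qed.

(** The integral is split over the atoms of [X]; on each of them [X] is constant
    and independence lets the mass of the atom factor out of the series over
    the atoms of [Y]. *)
Lemma poisson_expectation_mul {X Y} :
  poisson_rv P X -> poisson_rv P Y -> independent_rv P X Y ->
  (\int[P]_w (X w * Y w)%:E = 'E_P[X] * 'E_P[Y])%E.
Proof.
move=> hX hY hXY.
have [lx lx0 hx] := hX; have [ly ly0 hy] := hY.
have mX : measurable_fun setT (fun w => `|X w|) by exact: measurableT_comp.
have mY : measurable_fun setT (fun w => `|Y w|) by exact: measurableT_comp.
have EY : (\sum_(l <oo) (l%:R%:E * (poisson_pmf ly l)%:E) = 'E_P[Y])%E.
  by rewrite (poisson_expectation ly0 hy) poisson_pmf_mean.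
have EX : (\sum_(l <oo) (l%:R%:E * (poisson_pmf lx l)%:E) = 'E_P[X])%E.
  by rewrite (poisson_expectation lx0 hx) poisson_pmf_mean.
transitivity (\int[P]_w (`|X w| * `|Y w|)%:E)%E.
  apply: ae_eq_integral => //.
  - by apply/measurable_EFinP; exact: measurable_funM.
  - by apply/measurable_EFinP; exact: measurable_funM.
  - apply: filterS2 (poisson_rv_ae_normr hX) (poisson_rv_ae_normr hY).
    by move=> w /= -> -> _.
rewrite (ge0_integral_atoms hX)//; last first.
  by apply/measurable_EFinP; exact: measurable_funM.
transitivity (\sum_(k <oo) ('E_P[Y] * (k%:R%:E * (poisson_pmf lx k)%:E)))%E.
  apply: eq_eseriesr => k _; rewrite setTI.
  transitivity (\int[P]_(w in X @^-1` [set k%:R]) (k%:R%:E * `|Y w|%:E))%E.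
    by apply: eq_integral => w; rewrite inE/= EFinM => ->; rewrite normr_nat.
  rewrite ge0_integralZl_EFin//; last first.
    by apply/measurable_EFinP; exact: measurable_funTS.
  rewrite (ge0_integral_comp_atoms hY)//.
  rewrite muleCA; congr (_ * _)%E.
  rewrite muleC -EY -nneseriesZl; last first.
    by move=> l _; rewrite mule_ge0 ?lee_fin ?poisson_pmf_ge0.
  apply: eq_eseriesr => l _; rewrite normr_nat hXY// hx hy.
  by rewrite muleCA.
rewrite (poisson_expectation ly0 hy) nneseriesZl ?EX; first exact: muleC.
by move=> l _; rewrite mule_ge0 ?lee_fin ?poisson_pmf_ge0.
Qed.

End poisson_moments.

(** * The expected loss for unit rates *)

Definition mean_loss {R : realType} (t : R) : R := - t + expR (expR t - 1).

Lemma compact_norm_le {R : realType} {K : set R} : compact K ->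
  exists2 B : R, 1 <= B & forall t, K t -> `|t| <= B.
Proof.
move=> /compact_bounded[N [_ KN]].
exists (Num.max N 0 + 1); first by rewrite lerDr le_max lexx orbT.
by apply: KN; rewrite ltr_pwDr// le_max lexx.
Qed.

(** The tangent to the outer exponential at [y = exp m - 1], with [m] the
    midpoint, carries the convexity gap [q] of the inner exponential over to
    [F] with the factor [exp y >= exp (-1)]. *)
Lemma assumption1_mean_loss {R : realType} : assumption1 (@mean_loss R).
Proof.
move=> K /compact_norm_le[B B1 KB].
have B0 : 0 < B by exact: lt_le_trans B1.
(* Half of this constant is exp (-1) times the modulus expR (- B) / (4 * B) of
   the inner exponential. *)
exists (expR (- 1) * expR (- B) / (2 * B)).
  by rewrite divr_gt0 ?mulr_gt0 ?expR_gt0.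
move=> a t1 t2 a01 /KB t1B /KB t2B.
have /andP[a0 a1] := a01.
have sc := expR_strongly_convex B1 t1B t2B a01.
rewrite /mean_loss real_normK ?num_real//.
set m := a * t1 + (1 - a) * t2 in sc *.
set q := expR (- B) / (4 * B) * a * (1 - a) * (t1 - t2) ^+ 2 in sc *.
have a1' : 0 <= 1 - a by rewrite subr_ge0.
have q0 : 0 <= q.
  have ? : 0 <= expR (- B) / (4 * B) by rewrite divr_ge0 ?expR_ge0//; lra.
  by rewrite /q; apply: mulr_ge0 (sqr_ge0 _); apply: mulr_ge0 a1'; exact: mulr_ge0.
have -> : expR (- 1) * expR (- B) / (2 * B) / 2 * a * (1 - a) * (t1 - t2) ^+ 2
    = expR (- 1) * q by rewrite /q; field; lra.
set y := expR m - 1 in sc *.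
have tangent u : expR y * (1 + (u - y)) <= expR u.
  rewrite [expR u](_ : _ = expR y * expR (u - y)); last by rewrite -expRD subrKC.
  by rewrite ler_wpM2l ?expR_ge0 ?expR_ge1Dx.
have h1 := ler_wpM2l a0 (tangent (expR t1 - 1)).
have h2 := ler_wpM2l a1' (tangent (expR t2 - 1)).
have ey : expR (- 1) <= expR y by rewrite ler_expR /y; have := expR_ge0 m; lra.
have e0 := expR_ge0 y.
have h3 : expR (- 1) * q <= expR y * (a * expR t1 + (1 - a) * expR t2 - expR m).
  by apply: ler_pM => //; lra.
move: h1 h2 h3; rewrite /y /m.
set E := expR (_ - 1); set e1 := expR (expR t1 - 1); set e2 := expR (expR t2 - 1).
by move=> h1 h2 h3; lra.
Qed.

Lemma argmin_mean_loss {R : realType} : argmin (@mean_loss R) = [set 0].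
Proof.
have lb (t : R) : t != 0 -> 1 < mean_loss t.
  move=> t0; rewrite /mean_loss.
  by have := expR_gt1Dx t0; have := expR_ge1Dx (expR t - 1); lra.
have F0 : mean_loss 0 = 1 :> R.
  by rewrite /mean_loss expR0 subrr expR0 oppr0 add0r.
apply/seteqP; split => [t mint|_ -> t] /=; last first.
  by rewrite F0; have [->|/lb/ltW//] := eqVneq t 0; rewrite F0.
by apply/eqP; apply: contraT => /lb; have := mint 0; rewrite F0; lra.
Qed.

Theorem proposition3 (R : realType) (d : measure_display)
    (T : measurableType d) (P : probability T R) (X Y : {RV P >-> R})
    (hX : poisson_rv P X) (hY : poisson_rv P Y)
    (hXY : independent_rv P X Y)
    (EX : 'E_P[X]%E = 1%E) (EY : 'E_P[Y]%E = 1%E) :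
  let Z : T -> R * R := fun w => (X w, Y w) in
  let F : R -> R := objective P Z poisson_loss in
  (forall t : R, P.-integrable setT (fun w => (poisson_loss t (Z w))%:E)) /\
  exists tstar : R,
    [/\ argmin F = [set tstar],
        assumption1 F
      & assumption2 P Z poisson_loss tstar 1].
Proof.
move=> Z F.
have mgf t : (\int[P]_w (expR (t * X w))%:E = (expR (expR t - 1))%:E)%E.
  have [lambda l0 hp] := hX.
  move: EX; rewrite (poisson_expectation l0 hp) => -[l1].
  by rewrite (poisson_mgf _ l0 hp) l1 mul1r.
have iXY : P.-integrable setT (fun w => (X w * Y w)%:E).
  apply: (integrable_exp_bound 2 hX hY).
    exact: measurable_funM.
  move=> w; rewrite normrM -(mulr1 2).
  apply: le_trans (expRM_le_add _ _ _).
  by rewrite !mul1r ler_pM// normr_le_expR.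
have iLin t : P.-integrable setT (fun w => (- t)%:E * (X w * Y w)%:E)%E.
  exact: integrableZl.
have lossE t : (fun w => (poisson_loss t (Z w))%:E) =
    (fun w => (- t)%:E * (X w * Y w)%:E + (expR (t * X w))%:E)%E.
  apply/funext => w; rewrite -EFinM -EFinD /poisson_loss /Z/=.
  by congr EFin; ring.
have iExp t := integrable_poisson_expR t hX.
have FE : F = mean_loss.
  apply/funext => t; rewrite /F /objective unlock lossE.
  rewrite integralD// integralZl// mgf poisson_expectation_mul// EX EY.
  by rewrite mul1e mule1.
split => [t|].
  by rewrite lossE; apply: integrableD.
exists 0; rewrite FE; split.
- exact: argmin_mean_loss.
- exact: assumption1_mean_loss.
split.
- by rewrite ltr01 lexx.
- exact: poisson_loss_C2.
- (* |X^2| <= exp (2 |X|) *)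
  under eq_fun do rewrite nabla2_poisson_loss mul0r expR0 mulr1.
  apply: (integrable_exp_bound 2 hX hX).
    by apply: measurableT_comp => //; exact: measurable_funX.
  move=> w; rewrite normr_id normrX expRM_natl.
  have h := normr_le_expR (X w).
  rewrite (le_trans (_ : _ <= expR `|X w| ^+ 2))// ?lerXn2r ?nnegrE ?expR_ge0//.
  by rewrite lerDl exprn_ge0 ?expR_ge0.
- (* (X (1 - Y))^2 <= (exp |X| exp |Y|)^2 <= exp (4 |X|) + exp (4 |Y|) *)
  under eq_fun do rewrite nabla1_poisson_loss mul0r expR0 mulr1 -[1 + 1]/(2%:R)
    powR_mulrn//.
  apply: (integrable_exp_bound 4 hX hY).
    apply: measurable_funX; apply: measurableT_comp => //.
    apply: measurable_funD => //; apply: measurableT_comp => //.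
    exact: measurable_funM.
  move=> w; rewrite normrX normr_id.
  rewrite [4](_ : _ = 2 * 2); last by ring.
  apply: le_trans (expRM_le_add _ _ _).
  rewrite !expRM_natl -exprMn lerXn2r ?nnegrE ?mulr_ge0 ?expR_ge0//.
  rewrite /Z/= [- _ + _](_ : _ = X w * (1 - Y w)); last by ring.
  rewrite normrM ler_pM// ?normr_le_expR//.
  apply: le_trans (expR_ge1Dx _); apply: le_trans (ler_normB _ _) _.
  by rewrite normr1.
- move=> K /compact_norm_le[B B1 KB].
  exists (fun z => `|z.1| ^+ 3 * expR (B * `|z.1|)).
  have mM : measurable_fun setT
      (fun z : R * R => `|z.1| ^+ 3 * expR (B * `|z.1|)).
    have mn : measurable_fun setT (fun z : R * R => `|z.1|).
      exact: measurableT_comp.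
    apply: measurable_funM; first exact: measurable_funX.
    by apply: measurableT_comp => //; exact: measurable_funM.
  split => //.
  + (* |X|^3 exp (B |X|) <= exp ((3 + B) |X|) *)
    apply: (integrable_exp_bound (3 + B) hX hX).
      apply: (measurableT_comp mM).
      exact: measurable_fun_pair.
    move=> w; rewrite ger0_norm ?mulr_ge0 ?exprn_ge0 ?expR_ge0//=.
    rewrite mulrDl expRD expRM_natl.
    apply: (@le_trans _ _ (expR `|X w| ^+ 3 * expR (B * `|X w|))).
      by rewrite ler_wpM2r ?expR_ge0// lerXn2r ?nnegrE ?expR_ge0 ?normr_le_expR.
    by rewrite lerDl mulr_ge0 ?exprn_ge0 ?expR_ge0.
  + apply: aeW => w t t' /KB tB /KB t'B.
    rewrite !nabla2_poisson_loss.
    exact: poisson_hessian_lipschitz.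
Qed.
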